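(* Let $\mathbb{F}$ be a field. There is a constant $c>0$ such that, with $S=c\cdot n^2$: if there is a polynomial-time algorithm that, given an $n\times n$ matrix with entries in $M_S(\mathbb{F})$, computes its Moore determinant, then there is a polynomial-time algorithm that, given a directed graph $G$ on $n$ vertices, computes $H(G)$.
   Context: For $\sigma\in S_n$, write $\sigma$ as a product of disjoint cycles with each cycle starting at its smallest element and the cycles ordered by decreasing first elements $c_{11}>c_{21}>\cdots>c_{r1}$, and let $w_\sigma(B)=\prod_{i=1}^r\big(B(c_{i1},c_{i2})B(c_{i2},c_{i3})\cdots B(c_{il_i},c_{i1})\big)$ in that order. The Moore determinant of an $n\times n$ matrix $B$ over a ring is $\mathrm{Mdet}_n(B)=\sum_{\sigma\in S_n}\mathrm{sgn}(\sigma)w_\sigma(B)$. $H(G)$ is the number of directed Hamiltonian cycles of $G$, viewed as an element of $\mathbb{F}$ (i.e. the exact count if $\mathbb{F}$ has characteristic $0$, and the count modulo $k$ if $\mathbb{F}$ has characteristic $k$); equivalently $H(G)=\sum_{\sigma\in C_n}w_\sigma(A)$ where $A$ is the adjacency matrix of $G$ over $\mathbb{F}$ and $C_n$ is the set of $n$-cycles in $S_n$. *)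

(* Defs.v *)
From HB Require Import structures.
From mathcomp Require Import all_boot all_order all_algebra all_fingroup.

Set Implicit Arguments.
Unset Strict Implicit.
Unset Printing Implicit Defensive.

Import GRing.Theory.
Local Open Scope ring_scope.

Section Moore.

Variables (R : pzRingType) (n : nat).
Implicit Types (B : 'M[R]_n) (s : 'S_n).

Definition cycle_min s (i : 'I_n) : bool :=
  [forall j in porbit s i, (i <= j)%N].

(* [fingraph.orbit s i] is the sequence i, s i, s (s i), ... listing the cycle
   of i from i onwards.  Both products are ordered (R need not be commutative):
   the outer one runs over the smallest elements of the cycles of s, in
   decreasing order. *)
Definition moore_word B s : R :=
  \prod_(i <- rev (enum 'I_n) | cycle_min s i)
    \prod_(j <- fingraph.orbit s i) B j (s j).

Definition Mdet B : R := \sum_(s : 'S_n) (-1) ^+ s * moore_word B s.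

End Moore.

Section Hamilton.

Variables (n : nat) (G : rel 'I_n).

Definition full_cycle (s : 'S_n) : bool := #|porbits s| == 1%N.

(* A directed Hamiltonian cycle is given by its successor permutation. *)
Definition ham_cycles : {set 'S_n} :=
  [set s : 'S_n | full_cycle s & [forall i, G i (s i)]].

Definition ham_number (F : fieldType) : F := #|ham_cycles|%:R.

End Hamilton.

(* Algorithms over F: while-programs on a random access memory with two kinds
   of cells, natural numbers (for counters and addresses) and elements of F.
   Each kind is organised in arrays: [nmem s a i], [fmem s a i] are the i-th
   cells of the arrays number a.  Arithmetic in F is exact and, as in the
   Blum-Shub-Smale model, has unit cost, can use finitely many constants of F,
   and allows tests for 0.  There is deliberately no multiplication of natural
   numbers: with unit-cost multiplication the running time would no longer be
   polynomially related to the usual one. *)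
Section Programs.

Variable F : fieldType.

Inductive nexp : Type :=
| NConst of nat
| NGet of nat & nexp
| NAdd of nexp & nexp
| NSub of nexp & nexp.

Inductive fexp : Type :=
| FConst of F
| FGet of nat & nexp
| FAdd of fexp & fexp
| FMul of fexp & fexp
| FOpp of fexp
| FInv of fexp.

Inductive test : Type :=
| TLe of nexp & nexp
| TZero of fexp.

Inductive prog : Type :=
| Skip
| NSet of nat & nexp & nexp
| FSet of nat & nexp & fexp
| Seq of prog & prog
| If of test & prog & prog
| While of test & prog.

Record store : Type := Store {
  nmem : nat -> nat -> nat;
  fmem : nat -> nat -> F
}.

Definition upd (T : Type) (m : nat -> nat -> T) (a i : nat) (v : T) :=
  fun b j => if (b == a) && (j == i) then v else m b j.

Fixpoint neval (s : store) (e : nexp) : nat :=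
  match e with
  | NConst k => k
  | NGet a e1 => nmem s a (neval s e1)
  | NAdd e1 e2 => (neval s e1 + neval s e2)%N
  | NSub e1 e2 => (neval s e1 - neval s e2)%N
  end.

(* The inverse is MathComp's total one: 0^-1 = 0. *)
Fixpoint feval (s : store) (e : fexp) : F :=
  match e with
  | FConst x => x
  | FGet a e1 => fmem s a (neval s e1)
  | FAdd e1 e2 => feval s e1 + feval s e2
  | FMul e1 e2 => feval s e1 * feval s e2
  | FOpp e1 => - feval s e1
  | FInv e1 => (feval s e1)^-1
  end.

Definition teval (s : store) (b : test) : bool :=
  match b with
  | TLe e1 e2 => (neval s e1 <= neval s e2)%N
  | TZero e => feval s e == 0
  end.

(* [exec p s t s']: started in s, the program p halts in s' after t steps.
   Charging 1 for a whole assignment or test only changes running times by a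
   constant factor, since the expressions in a fixed program have bounded
   size. *)
Inductive exec : prog -> store -> nat -> store -> Prop :=
| ExSkip s : exec Skip s 1 s
| ExNSet s a i e :
    exec (NSet a i e) s 1
      (Store (upd (nmem s) a (neval s i) (neval s e)) (fmem s))
| ExFSet s a i e :
    exec (FSet a i e) s 1
      (Store (nmem s) (upd (fmem s) a (neval s i) (feval s e)))
| ExSeq p q s1 s2 s3 t1 t2 :
    exec p s1 t1 s2 -> exec q s2 t2 s3 -> exec (Seq p q) s1 (t1 + t2)%N s3
| ExIfTrue b p q s s' t :
    teval s b -> exec p s t s' -> exec (If b p q) s t.+1 s'
| ExIfFalse b p q s s' t :
    ~~ teval s b -> exec q s t s' -> exec (If b p q) s t.+1 s'
| ExWhileTrue b p s1 s2 s3 t1 t2 :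
    teval s1 b -> exec p s1 t1 s2 -> exec (While b p) s2 t2 s3 ->
    exec (While b p) s1 (t1 + t2).+1 s3
| ExWhileFalse b p s :
    ~~ teval s b -> exec (While b p) s 1 s.

(* Input convention: n is in cell 0 of the natural-number array 0, the word w
   is at the beginning of the field array 0, and all other cells are 0. *)
Definition load (n : nat) (w : seq F) : store :=
  Store (fun a i => if (a == 0%N) && (i == 0%N) then n else 0%N)
        (fun a i => if a == 0%N then w`_i else 0).

(* A problem has, for each n, instances [I n], encoded by words over F; [f]
   is the word expected at the beginning of the field array 0 on halting.
   A single program serves all n.  For the problems considered here the length
   of the encoding is a monomial in n of positive degree, so a bound polynomial
   in n and one polynomial in the length of the input amount to the same. *)
Definition poly_time (I : nat -> Type) (enc f : forall n, I n -> seq F) : Prop :=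
  exists (p : prog) (a d : nat), forall (n : nat) (x : I n),
    exists (t : nat) (s' : store),
      [/\ exec p (load n (enc n x)) t s',
          (t <= a * n ^ d + a)%N
        & forall k, (k < size (f n x))%N -> fmem s' 0 k = (f n x)`_k].

(* Row-major encodings. *)
Definition mx_word (m p : nat) (A : 'M[F]_(m, p)) : seq F :=
  [seq A i j | i <- enum 'I_m, j <- enum 'I_p].

Definition mxmx_word (n S : nat) (B : 'M['M[F]_S]_n) : seq F :=
  flatten [seq mx_word (B i j) | i <- enum 'I_n, j <- enum 'I_n].

Definition graph_word (n : nat) (G : rel 'I_n) : seq F :=
  mx_word (\matrix_(i < n, j < n) (G i j)%:R).

Definition moore_poly_time (S : nat -> nat) : Prop :=
  poly_time (I := fun n => 'M['M[F]_(S n)]_n)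
    (fun n B => mxmx_word B) (fun n B => mx_word (Mdet B)).

Definition ham_poly_time : Prop :=
  poly_time (I := fun n => rel 'I_n)
    (fun n G => graph_word G) (fun n G => [:: ham_number G F]).

End Programs.

(* Main.v *)
(** Let [A] be the adjacency matrix, and replace the entry in position (i, j) by
    [A i j] times the matrix unit E_01 if i = 0, and by [- A i j] times E_11 if
    i > 0.  Since E_01 E_11 = E_01 while E_11 M has zero row 0, the (0, 1) entry
    of a Moore word vanishes unless its first cycle starts at 0; as cycles come
    in decreasing order of their smallest elements, this means that there is
    only one cycle.  The n - 1 minus signs cancel the sign of an n-cycle, so the
    (0, 1) entry of the Moore determinant is the number of Hamiltonian cycles. *)

Require Import Defs.
From HB Require Import structures.
From mathcomp Require Import all_boot all_order all_algebra all_fingroup zify.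
From Stdlib Require Import FunctionalExtensionality.

Set Implicit Arguments.
Unset Strict Implicit.
Unset Printing Implicit Defensive.

Import GRing.Theory.
Local Open Scope ring_scope.

(** * Full cycles, cycle minima and orbits of a permutation *)

Lemma full_cycleP n (s : 'S_n.+1) :
  reflect (forall j, j \in porbit s ord0) (full_cycle s).
Proof.
apply: (iffP cards1P) => [[P sP] j|s0].
  have inP i : porbit s i = P by apply/set1P; rewrite -sP imset_f.
  by rewrite (inP ord0) -(inP j) porbit_id.
exists (porbit s ord0); apply/setP=> P; apply/imsetP/set1P => [[j _ ->]|->].
  by apply/eqP; rewrite eq_porbit_mem.
by exists ord0.
Qed.

Lemma porbit_min n (s : 'S_n) j : exists2 i, i \in porbit s j & cycle_min s i.
Proof.
case: (arg_minnP (fun i : 'I_n => i : nat) (porbit_id s j)) => i ij imin.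
exists i => //; apply/forallP=> k; apply/implyP=> ki; apply: imin.
by move: ki; rewrite -(eqP (etrans (eq_porbit_mem s j i) _)) // porbit_sym.
Qed.

Lemma orbit_cons (T : finType) (f : T -> T) x :
  fingraph.orbit f x = x :: behead (fingraph.orbit f x).
Proof. by rewrite /fingraph.orbit -orderSpred. Qed.

Lemma mem_orbit_perm (T : finType) (s : {perm T}) x y :
  (y \in fingraph.orbit s x) = (y \in porbit s x).
Proof.
rewrite -fconnect_orbit; apply/idP/porbitP => [/iter_findex <-|[i ->]].
  by exists (findex s x y); rewrite permX.
by rewrite permX fconnect_iter.
Qed.

(** * The matrix with block entries and its Moore words *)

Section GadgetMatrix.
Variables (F : fieldType) (S n : nat).
Implicit Type A : 'M[F]_n.

(** [b] is coerced to a row index: this is [x] E_01 for [false] and [x] E_11 for [true], padded with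
    zeros to size [S]. *)
Definition gadget (b : bool) (x : F) : 'M[F]_S :=
  \matrix_(k, l) if (k == b :> nat) && (l == 1%N :> nat) then x else 0.

Definition gadget_mx A : 'M['M[F]_S]_n :=
  \matrix_(i, j) gadget (0 < i)%N (if i == 0%N :> nat then A i j else - A i j).

Lemma gadget_mxE A i j :
  gadget_mx A i j
    = gadget (0 < i)%N (if i == 0%N :> nat then A i j else - A i j).
Proof. by rewrite mxE. Qed.

End GadgetMatrix.

Arguments gadget {F} S b x.
Arguments gadget_mx {F} S {n} A.

Lemma gadget_mul (F : fieldType) (S : nat) b (x y : F) : (1 < S)%N ->
  gadget S b x * gadget S true y = gadget S b (x * y).
Proof.
move=> S1; apply/matrixP=> k l; rewrite -mulmxE !mxE.
rewrite (bigD1 (Ordinal S1)) //= big1 ?addr0 => [|m m1]; rewrite !mxE /= ?andbT.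
  by case: (k == b :> nat) (l == 1%N :> nat) => -[]; rewrite /= ?(mul0r, mulr0).
by rewrite [m == 1%N :> nat](negbTE m1) andbF mul0r.
Qed.

Lemma gadget_mul_prod (F : fieldType) (S : nat) b (x : F) I r (y : I -> F) :
  (1 < S)%N ->
  gadget S b x * \prod_(i <- r) gadget S true (y i)
    = gadget S b (x * \prod_(i <- r) y i).
Proof.
move=> S1; elim: r x => [|i r IH] x; first by rewrite !big_nil !mulr1.
by rewrite !big_cons mulrA gadget_mul // IH mulrA.
Qed.

Lemma gadget_true_row0 (F : fieldType) (S : nat) (x : F) (M : 'M[F]_S) (k l : 'I_S) :
  k = 0%N :> nat -> (gadget S true x * M) k l = 0.
Proof.
by move=> k0; rewrite -mulmxE mxE big1 // => m _; rewrite mxE k0 mul0r.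
Qed.

Section GadgetWord.
Variables (F : fieldType) (S n : nat) (A : 'M[F]_n.+1) (s : 'S_n.+1).
Hypothesis S1 : (1 < S)%N.

(** The only cycle starts at 0, so one factor E_01 is followed by factors E_11. There are [n.+1]
    indices, hence [n] minus signs. *)
Lemma moore_word_gadget_full (k l : 'I_S) : k = 0%N :> nat -> l = 1%N :> nat ->
  full_cycle s ->
  moore_word (gadget_mx S A) s k l = (-1) ^+ n * \prod_i A i (s i).
Proof.
move=> k0 l1 /full_cycleP s0.
have minE i : cycle_min s i = (i == ord0).
  apply/forallP/eqP => [h|-> j]; last by apply/implyP.
  apply/val_inj/eqP; rewrite /= -leqn0; apply: (implyP (h ord0)).
  by rewrite porbit_sym.
rewrite /moore_word (eq_bigl _ _ minE) -big_filter filter_rev.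
rewrite (_ : [seq i <- enum 'I_n.+1 | i == ord0] = [:: ord0]); last first.
  by rewrite filter_pred1_uniq ?enum_uniq // mem_enum.
rewrite big_seq1 orbit_cons big_cons.
have uo := orbit_uniq s ord0; rewrite orbit_cons /= in uo.
case/andP: uo => no uo.
have memo j : (j \in behead (fingraph.orbit s ord0)) = (j != ord0).
  case: (eqVneq j ord0) => [->|j0]; first exact: negbTE.
  have := s0 j; rewrite -mem_orbit_perm.
  by rewrite orbit_cons inE (negbTE j0).
rewrite big_seq (eq_bigr (fun j => gadget S true (- A j (s j)))); last first.
  move=> j; rewrite memo gadget_mxE => j0.
  by rewrite lt0n [_ == 0%N](negbTE j0).
rewrite -big_seq gadget_mxE /= gadget_mul_prod // mxE k0 l1 eqxx /=.
rewrite [in RHS](bigD1 ord0) //=.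
rewrite mulrCA; congr (_ * _).
rewrite big_uniq // (eq_bigl _ _ memo) prodrN.
by rewrite cardC1 card_ord.
Qed.

Lemma moore_word_gadget_nonfull (k l : 'I_S) : k = 0%N :> nat ->
  ~~ full_cycle s -> moore_word (gadget_mx S A) s k l = 0.
Proof.
move=> k0 nfull.
have [i imin i0] : exists2 i, cycle_min s i & i != ord0.
  case: (pickP (fun j => j \notin porbit s ord0)) => [j nj|al]; last first.
    by case/negP: nfull; apply/full_cycleP=> j; apply/negbFE/al.
  have [i ij imin] := porbit_min s j; exists i => //.
  by apply: contraNneq nj => <-; rewrite porbit_sym.
(* The reversed enumeration ends with 0, so [r] below lists the positive cycle minima in decreasing
   order. It contains [i], and its head opens the word with a factor E_11. *)
rewrite /moore_word -big_filter enum_ordSl rev_cons filter_rcons.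
have -> : cycle_min s ord0 by apply/forallP=> j; apply/implyP.
set r := filter _ _.
have : i \in r.
  rewrite mem_filter imin mem_rev.
  by case: (unliftP ord0 i) i0 => [j ->|-> /eqP] // _; rewrite map_f ?mem_enum.
have : all (fun i : 'I_n.+1 => (0 < i)%N) r.
  rewrite all_filter all_rev; apply/allP=> j /mapP[m _ ->].
  exact/implyP.
case: r => // h r /= /andP[h0 _] _.
rewrite big_cons orbit_cons big_cons gadget_mxE h0 -!mulrA.
exact: gadget_true_row0.
Qed.

End GadgetWord.

Lemma Mdet_gadget (F : fieldType) (S n : nat) (G : rel 'I_n) (k l : 'I_S) :
  k = 0%N :> nat -> l = 1%N :> nat -> (0 < n)%N ->
  Mdet (gadget_mx S (\matrix_(i < n, j < n) (G i j)%:R)) k l = ham_number G F.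
Proof.
case: n G => // n G k0 l1 _.
have S1 : (1 < S)%N by rewrite -l1.
rewrite /Mdet summxE /ham_number -sum1_card natr_sum [RHS]big_mkcond /=.
apply: eq_bigr => s _; rewrite inE.
have sgE (M : 'M[F]_S) : ((-1) ^+ s * M) k l = (-1) ^+ s * M k l.
  by rewrite !mulr_sign; case: ifP => // _; rewrite mxE.
rewrite {}sgE.
case: ifP => [/andP[sfull /forallP sG]|].
  rewrite moore_word_gadget_full // mulrA (eq_bigr (fun=> 1)); last first.
    by move=> i _; rewrite mxE sG.
  (* A cycle on [n.+1] points has the parity of [n], so the two signs cancel. *)
  rewrite big1_eq mulr1 -(signr_odd _ n) -signr_addb.
  by rewrite /odd_perm (eqP sfull) card_ord /= addbT negbK addbb.
have [sfull /negbT|sfull _] := boolP (full_cycle s); last first.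
  by rewrite moore_word_gadget_nonfull ?mulr0.
rewrite negb_forall => /existsP[i nG].
rewrite moore_word_gadget_full // (bigD1 i) //= mxE (negbTE nG).
by rewrite mul0r !mulr0.
Qed.

(** * Positions in row-major encodings *)

Lemma nth_flatten_uniform (T : Type) (d : T) (ss : seq (seq T)) K i :
  (0 < K)%N -> all (fun s => size s == K) ss ->
  nth d (flatten ss) i = nth d (nth [::] ss (i %/ K)) (i %% K).
Proof.
move=> K0; elim: ss i => [|s ss IH] i /=; first by rewrite !nth_nil.
case/andP=> /eqP sK ssK; rewrite nth_cat sK.
case: ltnP => [iK|Ki]; first by rewrite divn_small // modn_small.
rewrite IH //.
by rewrite -{3 4}(subnK Ki) divnDr // divnn K0 addn1 modnDr.
Qed.

Lemma nth_allpairs (T1 T2 T : Type) (f : T1 -> T2 -> T) s t x0 y0 d i :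
  (i < size s * size t)%N ->
  nth d [seq f x y | x <- s, y <- t] i
    = f (nth x0 s (i %/ size t)) (nth y0 t (i %% size t)).
Proof.
move=> ilt; have t0 : (0 < size t)%N by case: (size t) ilt; rewrite ?muln0.
rewrite (@nth_flatten_uniform _ _ _ (size t)) //; last first.
  rewrite all_map (@eq_all _ _ predT) ?all_predT // => x.
  by rewrite /= size_map eqxx.
by rewrite (nth_map x0) ?ltn_divLR // (nth_map y0) ?ltn_mod.
Qed.

Lemma nth_enum_Ordinal n (i0 : 'I_n) i (lt_i_n : (i < n)%N) :
  nth i0 (enum 'I_n) i = Ordinal lt_i_n.
Proof. exact: (nth_ord_enum i0 (Ordinal lt_i_n)). Qed.

Lemma size_mx_word (F : fieldType) m p (A : 'M[F]_(m, p)) :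
  size (mx_word A) = (m * p)%N.
Proof. by rewrite size_allpairs !size_enum_ord. Qed.

Lemma nth_mx_word (F : fieldType) m p (A : 'M[F]_(m, p)) k
    (km : (k %/ p < m)%N) (kp : (k %% p < p)%N) :
  (mx_word A)`_k = A (Ordinal km) (Ordinal kp).
Proof.
have p0 : (0 < p)%N by case: p kp {A km}.
rewrite (nth_allpairs _ (Ordinal km) (Ordinal kp)) !size_enum_ord.
  by rewrite !nth_enum_Ordinal.
by rewrite -ltn_divLR.
Qed.

Lemma nth_mxmx_word (F : fieldType) n S (B : 'M['M[F]_S]_n) k
    (q := (k %/ (S * S))%N)
    (qm : (q %/ n < n)%N) (qp : (q %% n < n)%N) :
  (0 < S)%N ->
  (mxmx_word B)`_k
    = (mx_word (B (Ordinal qm) (Ordinal qp)))`_(k %% (S * S))%N.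
Proof.
move=> S0; have n0 : (0 < n)%N by case: n qp {B qm}.
rewrite (@nth_flatten_uniform _ _ _ (S * S)) ?muln_gt0 ?S0 //.
  rewrite -/q (nth_allpairs _ (Ordinal qm) (Ordinal qp)) !size_enum_ord.
    by rewrite !nth_enum_Ordinal.
  by rewrite -ltn_divLR.
apply/allP => /= s /allpairsP[[i j] [_ _ ->]].
by rewrite size_mx_word.
Qed.

(** * In-place expansion of the adjacency word into the block matrix word *)

Section Spread.
Variables (F : fieldType) (n S : nat) (w : seq F).
Local Notation K := (S * S)%N.
Local Notation N := (n * n)%N.

(** Entry [k] lies outside row 0 iff [n <= k]. In a row-major block of side [S], position (1, 1) has
    index [S.+1] and (0, 1) has index 1. *)
Definition entry_offset k := if (n <= k)%N then S.+1 else 1%N.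
Definition entry_value k := if (n <= k)%N then - w`_k else w`_k.

(* The contents of the memory once the entries of index at least [m] have been
   moved from the word [w] to their blocks of length [S * S].  The entries are
   moved in decreasing order, so that the move can be done in place: the target
   of entry [m] is never the source of an entry still to be moved. *)
Definition spread m i : F :=
  if (i < m)%N then w`_i else
  let k := (i %/ K)%N in
  if (m <= k < N)%N && (i %% K == entry_offset k)%N then entry_value k else 0.

Hypothesis S1 : (1 < S)%N.

Lemma entry_offset_lt k : (entry_offset k < K)%N.
Proof. rewrite /entry_offset; case: ifP => _; nia. Qed.

Lemma entry_offset_gt0 k : (0 < entry_offset k)%N.
Proof. by rewrite /entry_offset; case: ifP. Qed.

Lemma spread_all i : (size w <= N)%N -> spread N i = w`_i.
Proof.
move=> wN; rewrite /spread; case: ltnP => // Ni.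
by rewrite ltnNge andbN /= nth_default ?(leq_trans wN).
Qed.

(** The left side is the memory after writing entry [m] into its block and then clearing cell [m];
    the clearing comes last, so it is tested first. *)
Lemma spread_step m j : (m < N)%N ->
  (if j == m then 0
   else if j == (m * K + entry_offset m)%N then entry_value m
   else spread m.+1 j) = spread m j.
Proof.
move=> mN; have olt := entry_offset_lt m; have ogt := entry_offset_gt0.
have K0 : (0 < K)%N by apply: leq_ltn_trans olt.
rewrite /spread; case: eqVneq => [->|jm].
  (* Cell [m] could belong to a filled block only if [m <= m %/ K], that is [m = 0]; cell 0 is then
     empty because offsets are positive. *)
  rewrite ltnn; case: ifP => // /andP[/andP[mle _]].
  have -> : m = 0%N by move: mle; rewrite leq_divRL //; nia.
  by rewrite mod0n => /eqP o0; have := ogt (0 %/ K)%N; rewrite -o0.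
case: eqVneq => [->|jt].
  rewrite divnMDl // divn_small // addn0 modnMDl modn_small // leqnn mN eqxx /=.
  by rewrite ltnNge (leq_trans _ (leq_addr _ _)) // leq_pmulr.
rewrite ltnS leq_eqVlt (negbTE jm) /=; case: ltnP => // mj.
case: (eqVneq (j %/ K)%N m) => [jK|jK]; last by rewrite ltn_neqAle eq_sym jK.
rewrite jK ltnn leqnn mN /=; case: eqVneq => // jo.
by case/negP: jt; rewrite -jo -jK -divn_eq.
Qed.

End Spread.

Lemma spread_mxmx_word (F : fieldType) n S (A : 'M[F]_n) i :
  (1 < S)%N ->
  spread n S (mx_word A) 0 i = (mxmx_word (gadget_mx S A))`_i.
Proof.
move=> S1; have S0 := ltnW S1.
rewrite /spread ltn0 /=; set q := (i %/ (S * S))%N; set r := (i %% (S * S))%N.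
(* Beyond the last block both sides are 0, the right one by the default of [nth]. *)
case: ltnP => [qN|Nq]; last first.
  rewrite nth_default // /mxmx_word size_flatten sumnE big_map.
  rewrite (eq_big_seq (fun=> (S * S)%N)); last first.
    by move=> s /allpairsP[[k l] [_ _ ->]]; rewrite size_mx_word.
  rewrite big_const_seq count_predT size_allpairs !size_enum_ord iter_addn_0.
  by rewrite mulnC -leq_divRL ?muln_gt0 ?S0.
have n0 : (0 < n)%N by case: n qN {A}.
have qm : (q %/ n < n)%N by rewrite ltn_divLR.
have qp : (q %% n < n)%N by rewrite ltn_mod.
have rm : (r %/ S < S)%N by rewrite ltn_divLR // ltn_mod muln_gt0 S0.
have rp : (r %% S < S)%N by rewrite ltn_mod.
rewrite (nth_mxmx_word _ qm qp S0) -/r (nth_mx_word _ rm rp) gadget_mxE mxE /=.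
have -> : (0 < q %/ n)%N = (n <= q)%N by rewrite divn_gt0.
rewrite /entry_offset /entry_value (nth_mx_word _ qm qp).
have -> : (q %/ n == 0)%N = ~~ (n <= q)%N by rewrite -divn_gt0 // -eqn0Ngt.
(* Division by [S] splits the offset into the row, 0 or 1, and the column 1. *)
have -> : (r == (if n <= q then S.+1 else 1))%N
          = (r %/ S == (n <= q))%N && (r %% S == 1)%N.
  rewrite {1}(divn_eq r S); case: leqP => _ /=.
    apply/eqP/andP => [h|[/eqP-> /eqP->]]; last by rewrite mul1n addn1.
    have := congr1 (fun x => x %/ S)%N h; have := congr1 (fun x => x %% S)%N h.
    rewrite -[S.+1]addn1 modnMDl modnDl modn_mod divnMDl // divnDl // divnn S0.
    by rewrite !(divn_small S1) (divn_small rp) (modn_small S1) !addn0 => -> ->.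
  apply/eqP/andP => [h|[/eqP-> /eqP->]]; last by rewrite mul0n.
  have := congr1 (fun x => x %/ S)%N h; have := congr1 (fun x => x %% S)%N h.
  rewrite modnMDl modn_mod divnMDl //.
  by rewrite !(divn_small S1) (divn_small rp) (modn_small S1) !addn0 => -> ->.
by case: leqP; case: ifP.
Qed.

(** * The preprocessing program and its running time *)

Section Runs.
Variable F : fieldType.
Implicit Types (p q : prog F) (s : store F) (l : seq nat) (f : nat -> F).

Definition runs p s T s' := exists2 t, exec p s t s' & (t <= T)%N.

Lemma runs_leq p s T T' s' : (T <= T')%N -> runs p s T s' -> runs p s T' s'.
Proof. by move=> TT' [t ex tT]; exists t => //; apply: leq_trans TT'. Qed.

Lemma runs_seq p q s1 s2 s3 T1 T2 :
  runs p s1 T1 s2 -> runs q s2 T2 s3 -> runs (Seq p q) s1 (T1 + T2) s3.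
Proof.
move=> [t1 e1 l1] [t2 e2 l2]; exists (t1 + t2)%N; last exact: leq_add.
exact: ExSeq e1 e2.
Qed.

Lemma runs_if b p q s s' T :
  runs (if teval s b then p else q) s T s' -> runs (If b p q) s T.+1 s'.
Proof.
case: ifP => [sb|/negbT sb] [t e lt]; exists t.+1 => //.
  exact: ExIfTrue.
exact: ExIfFalse.
Qed.

(** [s k] is the store after [k] passes. Each pass also pays for its test, and the final failing
    test costs 1. *)
Lemma runs_while b p (s : nat -> store F) m T :
  (forall k, (k < m)%N -> teval (s k) b) ->
  (forall k, (k < m)%N -> runs p (s k) T (s k.+1)) ->
  ~~ teval (s m) b ->
  runs (While b p) (s 0%N) (m * T.+1 + 1) (s m).
Proof.
elim: m s => [|m IH] s sb sp sm; first by exists 1%N => //; exact: ExWhileFalse.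
have [t1 e1 l1] := sp 0%N isT.
have [t2 e2 l2] :=
  IH (fun k => s k.+1) (fun k => sb k.+1) (fun k => sp k.+1) sm.
exists (t1 + t2).+1; last by rewrite mulSn; lia.
by apply: ExWhileTrue e1 e2; apply: sb.
Qed.

(** The preprocessing uses only the arrays number 0. By the default of [nth], trailing zeros of [l]
    do not change the store. *)
Definition registers l f : store F :=
  Store (fun a i => if a == 0%N then nth 0%N l i else 0%N)
        (fun a i => if a == 0%N then f i else 0).

Lemma registersE l f n w : (forall i, nth 0%N l i = nth 0%N [:: n] i) ->
  (forall i, f i = w`_i) -> registers l f = load n w.
Proof.
move=> ln fw; congr Store; apply: functional_extensionality => a;
  apply: functional_extensionality => i; last by rewrite fw.
by rewrite ln; case: (a == 0%N) => //; case: i => [|[]].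
Qed.

Lemma runs_nset l f i e :
  runs (NSet F 0 (NConst i) e) (registers l f) 1
       (registers (set_nth 0%N l i (neval (registers l f) e)) f).
Proof.
exists 1%N => //; set v := neval _ e; rewrite [X in exec _ _ _ X](_ : _ =
  Store (upd (nmem (registers l f)) 0 (neval (registers l f) (NConst i)) v)
        (fmem (registers l f))); first exact: ExNSet.
congr Store; apply: functional_extensionality => a.
apply: functional_extensionality => j.
by rewrite /upd nth_set_nth /=; case: (a == 0%N).
Qed.

Lemma runs_fset l f i e :
  runs (FSet 0 i e) (registers l f) 1
       (registers l (fun j => if j == neval (registers l f) i
                              then feval (registers l f) e else f j)).
Proof.
exists 1%N => //; set v := feval _ e; rewrite [X in exec _ _ _ X](_ : _ =
  Store (nmem (registers l f))
        (upd (fmem (registers l f)) 0 (neval (registers l f) i) v));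
  first exact: ExFSet.
congr Store; apply: functional_extensionality => a.
apply: functional_extensionality => j.
by rewrite /upd /=; case: (a == 0%N).
Qed.

Definition reg i := NGet 0 (NConst i).

(* Correct only when registers [d] and 3 (the loop counter) initially hold 0. *)
Definition mul_prog d x y : prog F :=
  Seq (While (TLe F (NAdd (reg 3) (NConst 1)) x)
         (Seq (NSet F 0 (NConst d) (NAdd (reg d) y))
              (NSet F 0 (NConst 3) (NAdd (reg 3) (NConst 1)))))
      (NSet F 0 (NConst 3) (NConst 0)).

(** [l v c] has the partial product [v] in register [d] and the counter [c] in register 3; [x] and
    [y] must not depend on either. Each of the [a] additions costs 3, the last test and the reset 1
    each. *)
Lemma runs_mul (l : nat -> nat -> seq nat) f d x y a b :
  (forall v c, neval (registers (l v c) f) x = a) ->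
  (forall v c, neval (registers (l v c) f) y = b) ->
  (forall v c, nth 0%N (l v c) 3 = c) ->
  (forall v c, nth 0%N (l v c) d = v) ->
  (forall v c v', set_nth 0%N (l v c) d v' = l v' c) ->
  (forall v c c', set_nth 0%N (l v c) 3 c' = l v c') ->
  runs (mul_prog d x y) (registers (l 0 0)%N f) (a * 3 + 2)
       (registers (l (a * b) 0)%N f).
Proof.
move=> xE yE l3 ld sd s3; pose s k := registers (l (k * b) k)%N f.
rewrite (_ : a * 3 + 2 = (a * 3 + 1) + 1)%N; last by rewrite -addnA.
apply: (@runs_seq _ _ _ (s a)).
  apply: (@runs_while _ _ s a 2) => [k|k|] /=; rewrite ?xE ?l3 ?addn1 //.
  - move=> ka; apply: (@runs_seq _ _ _ (registers (l (k.+1 * b) k)%N f) _ 1 1).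
      have := runs_nset (l (k * b) k)%N f d (NAdd (reg d) y).
      by rewrite sd /= yE ld mulSnr.
    have := runs_nset (l (k.+1 * b) k)%N f 3 (NAdd (reg 3) (NConst 1)).
    by rewrite s3 /= l3 addn1.
  - by rewrite ltnn.
by have := runs_nset (l (a * b) a)%N f 3 (NConst 0); rewrite s3.
Qed.

(* Registers 0, 1, 2, 4 hold [n], [n * n], the size of a block and the
   address of the current block; the dimension of the blocks is [n * n + n * n]. *)
Definition move_entry : prog F :=
  Seq (NSet F 0 (NConst 3) (NSub (reg 3) (NConst 1)))
 (Seq (NSet F 0 (NConst 4) (NSub (reg 4) (reg 2)))
 (Seq (If (TLe F (reg 0) (reg 3))
         (FSet 0 (NAdd (reg 4) (NAdd (NAdd (reg 1) (reg 1)) (NConst 1)))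
                 (FOpp (FGet F 0 (reg 3))))
         (FSet 0 (NAdd (reg 4) (NConst 1)) (FGet F 0 (reg 3))))
      (FSet 0 (reg 3) (FConst 0)))).

Lemma runs_move_entry n (w : seq F) m (N := (n * n)%N) (S := (N + N)%N)
    (K := (S * S)%N) :
  (m < N)%N ->
  runs move_entry
    (registers [:: n; N; K; m.+1; (m.+1 * K)%N] (spread n S w m.+1)) 5
    (registers [:: n; N; K; m; (m * K)%N] (spread n S w m)).
Proof.
move=> mN; have S1 : (1 < S)%N by rewrite /S; lia.
apply: (@runs_seq _ _ _ _ _ 1 4).
  exact: runs_nset.
apply: (@runs_seq _ _ _ _ _ 1 3).
  exact: runs_nset.
rewrite /= subn1 /= mulSnr addnK.
apply: (@runs_seq _ _ _ (registers [:: n; N; K; m; (m * K)%N]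
  (fun j => if j == (m * K + entry_offset n S m)%N then entry_value n w m
            else spread n S w m.+1 j)) _ 2 1).
  (* Entry [m] is still in its original cell. *)
  have wm : spread n S w m.+1 m = w`_m by rewrite /spread ltnSn.
  apply: runs_if; rewrite /= /entry_offset /entry_value.
  case: ifP => _; rewrite -wm.
    have := runs_fset [:: n; N; K; m; (m * K)%N] (spread n S w m.+1)
      (NAdd (reg 4) (NAdd (NAdd (reg 1) (reg 1)) (NConst 1)))
      (FOpp (FGet F 0 (reg 3))).
    by rewrite /= addn1.
  exact: runs_fset.
have -> : spread n S w m = fun j => if j == m then 0
    else if j == (m * K + entry_offset n S m)%N then entry_value n w m
    else spread n S w m.+1 j.
  by apply: functional_extensionality => j; rewrite spread_step.
exact: runs_fset.
Qed.

(** The loop brings registers 3 and 4 back to 0 and the last two assignments clear 1 and 2, so the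
    final store obeys the input convention of [load]. *)
Definition prepare : prog F :=
  Seq (mul_prog 1 (reg 0) (reg 0))
 (Seq (mul_prog 2 (NAdd (reg 1) (reg 1)) (NAdd (reg 1) (reg 1)))
 (Seq (mul_prog 4 (reg 1) (reg 2))
 (Seq (NSet F 0 (NConst 3) (reg 1))
 (Seq (While (TLe F (NConst 1) (reg 3)) move_entry)
 (Seq (NSet F 0 (NConst 1) (NConst 0))
      (NSet F 0 (NConst 2) (NConst 0))))))).

Lemma runs_prepare n (A : 'M[F]_n) : (0 < n)%N ->
  runs prepare (load n (mx_word A)) (28 * n ^ 2)
    (load n (mxmx_word (gadget_mx (2 * n ^ 2) A))).
Proof.
move=> n0; have N0 : (0 < n * n)%N by rewrite muln_gt0 n0.
rewrite mul2n -addnn -mulnn; set N := (n * n)%N; set S := (N + N)%N.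
set w := mx_word A; set K := (S * S)%N.
have -> : load n w = registers [:: n; 0; 0; 0; 0]%N (spread n S w N).
  apply/esym/registersE => i; first by case: i => [|[|[|[|[|[]]]]]].
  by rewrite spread_all // /w size_mx_word.
have -> : load n (mxmx_word (gadget_mx S A))
    = registers [:: n; 0; 0; 0; 0]%N (spread n S w 0).
  apply/esym/registersE => i; first by case: i => [|[|[|[|[|[]]]]]].
  by rewrite spread_mxmx_word //; rewrite /S /N; lia.
(* The total is 15 n^2 + 3 n + 10, at most 28 n^2 since n > 0. *)
apply: (@runs_leq _ _ ((n * 3 + 2) + ((S * 3 + 2) + ((N * 3 + 2) + (1 +
  ((N * 6 + 1) + (1 + 1))))))%N).
  by rewrite /S /N; nia.
apply: (runs_seq (s2 := registers [:: n; N; 0; 0; 0]%N _)).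
  exact: (@runs_mul (fun v c => [:: n; v; 0; c; 0]%N)).
apply: (runs_seq (s2 := registers [:: n; N; K; 0; 0]%N _)).
  exact: (@runs_mul (fun v c => [:: n; N; v; c; 0]%N)).
apply: (runs_seq (s2 := registers [:: n; N; K; 0; N * K]%N _)).
  exact: (@runs_mul (fun v c => [:: n; N; K; c; v]%N)).
apply: (runs_seq (s2 := registers [:: n; N; K; N; N * K]%N _)).
  exact: runs_nset.
apply: (runs_seq (s2 := registers [:: n; N; K; 0; 0]%N (spread n S w 0))).
  (* The program counts down: after [k] passes, [N - k] entries remain to be moved. *)
  pose s k :=
    registers [:: n; N; K; N - k; (N - k) * K]%N (spread n S w (N - k)).
  have := @runs_while (TLe F (NConst 1) (reg 3)) move_entry s N 5.
  rewrite /s subn0 subnn mul0n; apply=> [k kN|k kN|] //=; first by lia.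
  rewrite -(subnSK kN); apply: runs_move_entry.
  by rewrite -/N; lia.
apply: (runs_seq (s2 := registers [:: n; 0; K; 0; 0]%N _)); exact: runs_nset.
Qed.

End Runs.

(** * The reduction *)

Lemma ham_number0 (F : fieldType) (G : rel 'I_0) : ham_number G F = 0.
Proof.
rewrite /ham_number (_ : ham_cycles G = set0) ?cards0 //.
apply/setP => s; rewrite !inE; apply/negbTE; rewrite negb_and; apply/orP; left.
(* The permutation of the empty set has no cycles. *)
apply/cards1P => -[P sP]; have : P \in porbits s by rewrite sP set11.
by case/imsetP => -[].
Qed.

Theorem theorem7p4 (F : fieldType) :
  exists c : nat, (0 < c)%N /\
    (moore_poly_time F (fun n => (c * n ^ 2)%N) -> ham_poly_time F).
Proof.
(* With c = 2 the blocks have size at least 2 already for n = 1, so E_01 and E_11 exist. *)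
exists 2%N; split=> // -[p [a [d pP]]].
(* For n = 0 the memory already holds the answer 0. Otherwise the (0, 1) entry of the determinant,
   in cell 1, is copied to cell 0. *)
exists (If (TLe F (reg 0) (NConst 0)) (Skip F)
  (Seq (prepare F) (Seq p (FSet 0 (NConst 0) (FGet F 0 (NConst 1)))))).
(* For n > 0 the time is at most 28 n^2 + (a n^d + a) + 2, and n^(d + 2) dominates both powers. *)
exists (a + 30)%N, (d + 2)%N => n G.
have [n0|n0] := posnP n.
  subst n; exists 2%N, (load 0 (graph_word F G)); split; last first.
  - by case=> // _; rewrite /= nth_default ?size_mx_word // ham_number0.
  - by lia.
  - by apply: ExIfTrue => //; apply: ExSkip.
set A := (\matrix_(i < n, j < n) (G i j)%:R : 'M[F]_n).
have [t [s [e tT out]]] := pP n (gadget_mx (2 * n ^ 2) A).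
have [t1 e1 t1T] := runs_prepare A n0.
have S1 : (1 < 2 * n ^ 2)%N by rewrite -mulnn; lia.
exists (t1 + (t + 1)).+1,
  (Store (nmem s) (upd (fmem s) 0 0 (fmem s 0%N 1%N))); split.
- apply: ExIfFalse; first by rewrite /= -ltnNge.
  apply: ExSeq e1 _; apply: ExSeq e _; exact: ExFSet.
- have nd : (n ^ d <= n ^ (d + 2))%N by rewrite leq_pexp2l ?leq_addr.
  have n2 : (n ^ 2 <= n ^ (d + 2))%N by rewrite leq_pexp2l ?leq_addl.
  have := leq_mul (leqnn a) nd; lia.
case=> // _; rewrite /upd /=.
have lt0 : (1 %/ (2 * n ^ 2) < 2 * n ^ 2)%N by rewrite divn_small // ltnW.
have lt1 : (1 %% (2 * n ^ 2) < 2 * n ^ 2)%N by rewrite modn_small.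
rewrite out; last by rewrite size_mx_word; nia.
by rewrite (nth_mx_word _ lt0 lt1) Mdet_gadget //= ?divn_small ?modn_small.
Qed.
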